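(* For every integer $k\ge 0$, $$\sup_{P_n\in\triangle_n}\frac{\|P_n'(x)\sqrt{1-x^2}\|}{\|P_n\|}=\begin{cases}2\,\bigl\|\sqrt{1-x^2}\,S_k(x)\bigr\|, & n=2k+2,\\[4pt] 2\max\Bigl(\bigl\|\sqrt{1-x^2}\,H_k(x)\bigr\|,\ \bigl\|\sqrt{1-x^2}\,F_k(x)\bigr\|\Bigr), & n=2k+1.\end{cases}$$
   Context: All polynomials are real algebraic polynomials in one variable. $\|f\|=\|f(x)\|=\max_{x\in[-1,1]}|f(x)|$ is the uniform norm on $[-1,1]$. $\triangle_n$ denotes the set of all polynomials of degree $n$ that are monotone (nondecreasing or nonincreasing) on $[-1,1]$. For $\alpha,\beta\in\{0,1\}$, $J_l^{(\alpha,\beta)}$ ($l=0,1,2,\dots$) denotes the orthonormal Jacobi polynomial of degree $l$ with respect to the weight $(1-x)^\alpha(1+x)^\beta$ on $[-1,1]$, i.e. $\deg J_l^{(\alpha,\beta)}=l$ and $$\int_{-1}^1 J_l^{(\alpha,\beta)}(x)J_m^{(\alpha,\beta)}(x)(1-x)^\alpha(1+x)^\beta\,dx=\delta_{lm}$$ (the sign of the leading coefficient is irrelevant below, since only squares occur). For integers $k\ge 0$ define $$S_k(x)=(1+x)\sum_{l=0}^{k}\bigl(J_l^{(0,1)}(x)\bigr)^2,\qquad H_k(x)=(1-x^2)\sum_{l=0}^{k-1}\bigl(J_l^{(1,1)}(x)\bigr)^2,\qquad F_k(x)=\sum_{l=0}^{k}\bigl(J_l^{(0,0)}(x)\bigr)^2,$$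 with the empty sum equal to zero, so $H_0=0$. *)

(* Defs.v *)
From HB Require Import structures.
From mathcomp Require Import all_boot all_order all_algebra.
From mathcomp Require Import all_classical all_reals all_analysis.
Set Implicit Arguments.
Unset Strict Implicit.
Unset Printing Implicit Defensive.
Import Order.TTheory GRing.Theory Num.Theory.
Import numFieldNormedType.Exports.
Local Open Scope classical_set_scope.
Local Open Scope ring_scope.

(* Uniform norm on [-1, 1]. For continuous f the supremum is a maximum, see
   unorm_attained; it is only ever applied to continuous functions. *)
Definition unorm (R : realType) (f : R -> R) : R :=
  sup [set `|f x| | x in `[-1, 1]].

Lemma unorm_attained (R : realType) (f : R -> R) :
  {within `[-1, 1], continuous f} ->
  exists2 c, c \in `[-1, 1] &
    unorm f = `|f c| /\ forall x, x \in `[-1, 1] -> `|f x| <= `|f c|.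
Proof.
move=> cf; have le11 : (-1 : R) <= 1 by rewrite lerNl (le_trans _ ler01)// lerN10.
have cnf : {within `[-1, 1], continuous (fun x => `|f x|)}.
  by move=> x; apply: continuous_comp; [exact: cf|exact: norm_continuous].
have [c c11 cmax] := EVT_max le11 cnf.
exists c => //; split => //; apply/eqP; rewrite eq_le; apply/andP; split.
- apply: ge_sup; first by exists `|f c|, c.
  by move=> _ [x x11 <-]; exact: cmax.
- apply: ub_le_sup; last by exists c.
  by exists `|f c| => _ [x x11 <-]; exact: cmax.
Qed.

Definition monotone_poly (R : realType) (n : nat) : set {poly R} :=
  [set P : {poly R} | size P = n.+1 /\
     ({in `[-1, 1] &, {homo horner P : x y / x <= y}} \/
      {in `[-1, 1] &, {homo horner P : x y /~ x <= y}})].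

Definition orthonormal_jacobi (R : realType) (a b : nat)
    (J : nat -> {poly R}) : Prop :=
  (forall l, size (J l) = l.+1) /\
  (forall l m, \int[lebesgue_measure]_(x in `[-1, 1])
     ((J l).[x] * (J m).[x] * (1 - x) ^+ a * (1 + x) ^+ b) = (l == m)%:R).

(* In the next three definitions J a b l stands for the orthonormal Jacobi
   polynomial J_l^(a, b). *)
Definition Sfun (R : realType) (J : nat -> nat -> nat -> {poly R})
    (k : nat) (x : R) : R :=
  (1 + x) * \sum_(0 <= l < k.+1) (J 0%N 1%N l).[x] ^+ 2.

Definition Hfun (R : realType) (J : nat -> nat -> nat -> {poly R})
    (k : nat) (x : R) : R :=
  (1 - x ^+ 2) * \sum_(0 <= l < k) (J 1%N 1%N l).[x] ^+ 2.

Definition Ffun (R : realType) (J : nat -> nat -> nat -> {poly R})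
    (k : nat) (x : R) : R :=
  \sum_(0 <= l < k.+1) (J 0%N 0%N l).[x] ^+ 2.

Definition bernstein_ratio (R : realType) (P : {poly R}) : R :=
  unorm (fun x => P^`().[x] * Num.sqrt (1 - x ^+ 2)) / unorm (horner P).

(* Main.v *)
(* For P monotone of degree n, Q = +-P' has constant sign, and centring P
   gives ||P|| = (1/2) int Q; so one has to maximise sqrt(1 - x^2) Q(x) / int Q
   over the polynomials Q >= 0 on [-1, 1] of degree at most n - 1, the exact
   degree being recovered by a small perturbation. By Lukacs' theorem, such a Q
   is a sum of terms (1 - X)^a (1 + X)^b A^2 with a, b <= 1. On each of them the
   supremum is given by the Christoffel function of the weight
   (1 - X)^a (1 + X)^b: the bound is the Cauchy-Schwarz inequality in the
   orthonormal basis, and equality holds for the reproducing kernel. The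
   reflection x -> -x exchanges the weights 1 - X and 1 + X. *)

Require Import Defs.
From HB Require Import structures.
From mathcomp Require Import all_boot all_order all_algebra.
From mathcomp Require Import all_classical all_reals all_analysis.
From mathcomp Require Import polyrcf ring lra zify.
Set Implicit Arguments.
Unset Strict Implicit.
Unset Printing Implicit Defensive.
Import Order.TTheory GRing.Theory Num.Theory.
Import numFieldNormedType.Exports.
Local Open Scope classical_set_scope.
Local Open Scope ring_scope.

(** * Lukacs representation of polynomials nonnegative on the interval *)

Definition nonneg11 (R : realType) (p : {poly R}) : Prop :=
  forall x, -1 <= x <= 1 -> 0 <= p.[x].

(** A negative value at [c] would persist nearby by continuity. This recovers the sign of a quotient
    at the zero that was divided out. *)
Lemma nonneg11_punctured (R : realType) (p : {poly R}) (c : R) :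
  -1 <= c <= 1 -> (forall x, -1 <= x <= 1 -> x != c -> 0 <= p.[x]) ->
  nonneg11 p.
Proof.
move=> /andP[c1 c2] pge x x11; have [->|/pge] := eqVneq x c; last exact.
rewrite leNgt; apply/negP => pc; have npc : 0 < - p.[c] by lra.
have [d d0 dP] := poly_cont c p npc.
have H y : -1 <= y <= 1 -> y != c -> `|y - c| < d -> False.
  by move=> y1 yc /dP; have := pge _ y1 yc; rewrite ltr_norml; lra.
set e := Num.min (d / 2) (1 / 2).
have e0 : 0 < e by rewrite lt_min; lra.
have [ed e1] : e <= d / 2 /\ e <= 1 / 2.
  by split; rewrite ge_min lexx ?orbT.
have [c0|c0] := leP c 0.
- by apply: (H (c + e)); [|apply/eqP|rewrite addrAC subrr add0r gtr0_norm]; lra.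
- by apply: (H (c - e));
    [|apply/eqP|rewrite addrAC subrr add0r normrN gtr0_norm]; lra.
Qed.

(* The relation [a + b + 2 s = n + 1] forces the degree of a generator to be at
   most [n - 1], and [a + b] to have the parity of [n + 1]. *)
Inductive lukacs (R : realType) (n : nat) : {poly R} -> Prop :=
| lukacs0 : lukacs n 0
| lukacsD p q : lukacs n p -> lukacs n q -> lukacs n (p + q)
| lukacs_gen (a b s : nat) (A : {poly R}) :
    (a <= 1)%N -> (b <= 1)%N -> (a + b + s.*2 = n.+1)%N -> (size A <= s)%N ->
    lukacs n ((1 - 'X) ^+ a * (1 + 'X) ^+ b * A ^+ 2).

(** If [b = 0], the new factor raises [b] to [1]; if [b = 1], the two copies of [1 + 'X] form a
    square that moves into [A], and [s] grows by one. *)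
Lemma lukacs_mulDX (R : realType) n (p : {poly R}) :
  lukacs n p -> lukacs n.+1 ((1 + 'X) * p).
Proof.
elim=> [|p1 p2 _ h1 _ h2|a b s A a1 b1 e sA];
  first by rewrite mulr0; exact: lukacs0.
  by rewrite mulrDr; exact: lukacsD.
case: b b1 e => [|[|//]] _ e.
  rewrite [X in lukacs _ X](_ : _ = (1 - 'X) ^+ a * (1 + 'X) ^+ 1 *
    A ^+ 2); last by set u := _ ^+ a; ring.
  by apply: (@lukacs_gen _ _ _ _ s) => //; lia.
rewrite [X in lukacs _ X](_ : _ =
    (1 - 'X) ^+ a * (1 + 'X) ^+ 0 * ((1 + 'X) * A) ^+ 2);
  last by set u := _ ^+ a; ring.
apply: (@lukacs_gen _ _ _ _ s.+1) => //; first by lia.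
apply: leq_trans (size_polyMleq _ _) _.
by rewrite addrC -[1]/(1%:P) size_XaddC; lia.
Qed.

Lemma lukacs_mulBX (R : realType) n (p : {poly R}) :
  lukacs n p -> lukacs n.+1 ((1 - 'X) * p).
Proof.
elim=> [|p1 p2 _ h1 _ h2|a b s A a1 b1 e sA];
  first by rewrite mulr0; exact: lukacs0.
  by rewrite mulrDr; exact: lukacsD.
case: a a1 e => [|[|//]] _ e.
  rewrite [X in lukacs _ X](_ : _ = (1 - 'X) ^+ 1 * (1 + 'X) ^+ b *
    A ^+ 2); last by set u := _ ^+ b; ring.
  by apply: (@lukacs_gen _ _ _ _ s) => //; lia.
rewrite [X in lukacs _ X](_ : _ =
    (1 - 'X) ^+ 0 * (1 + 'X) ^+ b * (('X - 1) * A) ^+ 2);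
  last by set u := _ ^+ b; ring.
apply: (@lukacs_gen _ _ _ _ s.+1) => //; first by lia.
apply: leq_trans (size_polyMleq _ _) _.
by rewrite -[1]/(1%:P) size_XsubC; lia.
Qed.

Lemma lukacs_mul_sqr (R : realType) n (c : R) (p : {poly R}) :
  lukacs n p -> lukacs n.+2 (('X - c%:P) ^+ 2 * p).
Proof.
elim=> [|p1 p2 _ h1 _ h2|a b s A a1 b1 e sA];
  first by rewrite mulr0; exact: lukacs0.
  by rewrite mulrDr; exact: lukacsD.
rewrite [X in lukacs _ X](_ : _ =
    (1 - 'X) ^+ a * (1 + 'X) ^+ b * (('X - c%:P) * A) ^+ 2);
  last by rewrite exprMn mulrCA.
apply: (@lukacs_gen _ _ _ _ s.+1) => //; first by lia.
by apply: leq_trans (size_polyMleq _ _) _; rewrite size_XsubC; lia.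
Qed.

(** For even [n] the constant is a square. For odd [n] a generator carries exactly one linear
    factor, so [c] is split over [1 - 'X] and [1 + 'X] with weight [c / 2] each. *)
Lemma lukacsC (R : realType) n (c : R) :
  0 <= c -> lukacs n.+1 c%:P.
Proof.
move=> c0; have [m nE] : exists m, n = (odd n + m.*2)%N.
  by exists n./2; rewrite odd_double_half.
case: (odd n) nE => nE.
  have h : c%:P = (1 - 'X) ^+ 1 * (1 + 'X) ^+ 0 * (Num.sqrt (c / 2))%:P ^+ 2
    + (1 - 'X) ^+ 0 * (1 + 'X) ^+ 1 * (Num.sqrt (c / 2))%:P ^+ 2.
    rewrite !expr0 !expr1 mulr1 mul1r -mulrDl -rmorphXn sqr_sqrtr; last by lra.
    rewrite (_ : 1 - 'X + (1 + 'X) = 2%:P) ?[2%:P]polyC_natr; last by ring.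
    by rewrite -polyC_natr -polyCM; congr _%:P; field.
  by rewrite h; apply: lukacsD; apply: (@lukacs_gen _ _ _ _ m.+1);
    rewrite ?(leq_trans (size_polyC_leq1 _))//; lia.
rewrite -[c]sqr_sqrtr// rmorphXn /= -[X in lukacs _ X]mul1r -[X in X * _]mul1r.
rewrite -[X in X * _ * _](expr0 (1 - 'X)) -[X in _ * X * _](expr0 (1 + 'X)).
by apply: (@lukacs_gen _ _ _ _ m.+1);
    rewrite ?(leq_trans (size_polyC_leq1 _))//; lia.
Qed.

(* Subtracting the minimum [m] of [p] creates a zero [c] in [[-1, 1]], which
   can be divided out: it is double if [c] is interior, and otherwise
   contributes a factor [1 - X] or [1 + X]. *)
Lemma nonneg11_lukacs (R : realType) n (p : {poly R}) :
  (size p <= n)%N -> nonneg11 p -> lukacs n p.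
Proof.
elim/ltn_ind: n p => -[|n] IH p sp p0.
  by move: sp; rewrite leqn0 size_poly_eq0 => /eqP->; exact: lukacs0.
have cp : {within `[-1, 1], continuous (horner p)}.
  by apply: continuous_subspaceT => x; exact: continuous_horner.
have le11 : (-1 : R) <= 1 by lra.
have [c c11 cmin] := EVT_min le11 cp.
move: c11; rewrite in_itv/= => c11.
have m0 : 0 <= p.[c] by exact: p0.
rewrite -[p](subrK p.[c]%:P); apply: lukacsD; last exact: lukacsC.
have /factor_theorem[q qE] : root (p - p.[c]%:P) c.
  by rewrite rootE !hornerE subrr.
have spc : (size (p - p.[c]%:P)%R <= n.+1)%N.
  apply: leq_trans (size_polyD _ _) _; rewrite geq_max sp size_polyN.
  by rewrite (leq_trans (size_polyC_leq1 _)).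
have sizeq (r s : {poly R}) (a : R) k : s = r * ('X - a%:P) ->
    (size s <= k.+1)%N -> (size r <= k)%N.
  move=> ->; have [->|r0] := eqVneq r 0; first by rewrite size_poly0.
  by rewrite size_Mmonic ?monicXsubC// size_XsubC; lia.
have sq := sizeq _ _ _ _ qE spc.
have pq x : -1 <= x <= 1 -> 0 <= q.[x] * (x - c).
  move=> x11; have := congr1 (horner^~ x) qE; rewrite !hornerE => <-.
  by rewrite subr_ge0; apply: cmin; rewrite in_itv.
have [c1|cN1] := eqVneq c (-1).
  rewrite qE mulrC c1 polyCN opprK addrC; apply/lukacs_mulDX/IH => //.
  apply: (@nonneg11_punctured _ _ (-1)); first by lra.
  move=> x x11 /eqP xc; have := pq x x11; rewrite pmulr_lge0//; lra.
have [c1|cD1] := eqVneq c 1.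
  rewrite qE mulrC c1 -mulrNN opprB; apply/lukacs_mulBX/IH => //.
    by rewrite size_polyN.
  apply: (@nonneg11_punctured _ _ 1); first by lra.
  move=> x x11 /eqP xc; have := pq x x11; rewrite nmulr_lge0 ?hornerN; lra.
(* At an interior minimum the derivative of [p] vanishes, and by the factorisation it equals
   [q.[c]]. *)
have qc : q.[c] = 0.
  have hc : c \in `]-1, 1[ by rewrite in_itv/= !lt_neqAle eq_sym cN1 cD1.
  have dp : is_derive c (1 : R) (horner p) 0.
    apply: (derive1_at_min le11 _ hc) => t t11; first exact: derivable_horner.
    by apply: cmin; exact: subset_itv_oo_cc t11.
  have := @derive_val _ _ _ _ _ _ _ dp.
  rewrite (@derive_val _ _ _ _ _ _ _ (is_derive_poly p c)).
  have := congr1 (fun r => r^`().[c]) qE.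
  by rewrite derivB derivC subr0 derivM derivXsubC !hornerE subrr mulr0 add0r =>
    ->.
have /factor_theorem[r rE] : root q c by rewrite rootE qc.
have pr : nonneg11 r.
  apply: (@nonneg11_punctured _ _ c) => // x x11 xc.
  have := pq x x11; rewrite rE !hornerE -mulrA -expr2 pmulr_lge0//.
  by rewrite exprn_even_gt0// subr_eq0.
rewrite qE rE -mulrA -expr2 mulrC.
(* A square lowers the level by two, so [n = 0] is treated apart: there [q] is zero. *)
case: n => [|n] in IH sp spc sq *.
  move: sq; rewrite leqn0 size_poly_eq0 => /eqP q0.
  by rewrite mulrC expr2 mulrA -rE q0 mul0r; exact: lukacs0.
by apply/lukacs_mul_sqr/IH => //; exact: sizeq rE sq.
Qed.

(** * Integration of polynomials over the interval *)

Definition int11 (R : realType) (p : {poly R}) : R :=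
  \int[lebesgue_measure]_(x in `[-1, 1]) p.[x].

Lemma int11_deriv (R : realType) (p : {poly R}) :
  int11 p^`() = p.[1] - p.[-1].
Proof.
rewrite /int11 /Rintegral (@continuous_FTC2 _ _ (horner p))//.
- by apply: continuous_subspaceT => x; exact: continuous_horner.
- split; first by move=> x _; exact: derivable_horner.
  + by apply: cvg_at_right_filter; exact: continuous_horner.
  + by apply: cvg_at_left_filter; exact: continuous_horner.
- by move=> x _; rewrite -derivE.
Qed.

(** At [i = 0] the division by [0%:R] gives [0], so the constant term vanishes. *)
Definition antideriv (R : realType) (p : {poly R}) : {poly R} :=
  \poly_(i < (size p).+1) (p`_i.-1 / i%:R).

Lemma deriv_antideriv (R : realType) (p : {poly R}) : (antideriv p)^`() = p.
Proof.
apply/polyP => i; rewrite coef_deriv coef_poly ltnS.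
case: ltnP => [_|sp]; last by rewrite mul0rn nth_default.
by rewrite /= -[LHS]mulr_natr divfK// pnatr_eq0.
Qed.

Lemma size_antideriv (R : realType) (p : {poly R}) :
  p != 0 -> size (antideriv p) = (size p).+1.
Proof.
move=> p0; apply: size_poly_eq.
rewrite mulf_neq0 ?invr_eq0 ?pnatr_eq0 ?size_poly_eq0//.
by rewrite -lead_coefE lead_coef_eq0.
Qed.

Lemma int11E (R : realType) (p : {poly R}) :
  int11 p = (antideriv p).[1] - (antideriv p).[-1].
Proof. by rewrite -int11_deriv deriv_antideriv. Qed.

(** Linearity is read off the endpoint values of antiderivatives, without integrability side
    conditions. *)
Lemma int11D (R : realType) (p q : {poly R}) :
  int11 (p + q) = int11 p + int11 q.
Proof.
rewrite -{1}[p]deriv_antideriv -{1}[q]deriv_antideriv -derivD int11_deriv.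
by rewrite !hornerD !int11E; ring.
Qed.

Lemma int11Z (R : realType) (c : R) (p : {poly R}) :
  int11 (c *: p) = c * int11 p.
Proof.
rewrite -{1}[p]deriv_antideriv -derivZ int11_deriv.
by rewrite !hornerZ !int11E; ring.
Qed.

Lemma int110 (R : realType) : int11 (0 : {poly R}) = 0.
Proof. by rewrite -(scale0r 0) int11Z mul0r. Qed.

Lemma int11_sum (R : realType) (I : eqType) (r : seq I) (F : I -> {poly R}) :
  int11 (\sum_(i <- r) F i) = \sum_(i <- r) int11 (F i).
Proof.
apply: big_morph; [exact: int11D|exact: int110].
Qed.

Lemma int11_compNX (R : realType) (p : {poly R}) :
  int11 (p \Po - 'X) = int11 p.
Proof.
rewrite -{1}[p]deriv_antideriv.
have -> : (antideriv p)^`() \Po - 'X = (- (antideriv p \Po - 'X))^`().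
  by rewrite derivN deriv_comp derivN derivX mulrN1 opprK.
by rewrite int11_deriv !hornerE !horner_comp !hornerE !opprK int11E addrC.
Qed.

(** * Cauchy-Schwarz inequality and Christoffel functions *)

Lemma sum_sqr_CauchySchwarz (R : realFieldType) (I : eqType) (r : seq I)
    (c x : I -> R) :
  (\sum_(i <- r) c i * x i) ^+ 2 <=
    (\sum_(i <- r) x i ^+ 2) * \sum_(i <- r) c i ^+ 2.
Proof.
set T := \sum_(i <- r) _; set X := \sum_(i <- r) _; set C := \sum_(i <- r) _.
have X0 : 0 <= X by apply: sumr_ge0 => i _; exact: sqr_ge0.
(* The squares sum to [X * (X * C - T ^+ 2)]. If [X = 0], every [x i] vanishes and so does [T];
   otherwise [X] cancels. *)
have : 0 <= \sum_(i <- r) (X * c i - T * x i) ^+ 2.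
  by apply: sumr_ge0 => i _; exact: sqr_ge0.
have -> : \sum_(i <- r) (X * c i - T * x i) ^+ 2 = X * (X * C - T ^+ 2).
  under eq_bigr => i _.
    rewrite (_ : _ ^+ 2 = X ^+ 2 * c i ^+ 2 + (- (2 * X * T)) * (c i * x i) +
      T ^+ 2 * x i ^+ 2); last by ring.
    over.
  rewrite !big_split /= -!mulr_sumr -/T -/X -/C; ring.
have [X1|Xp] := eqVneq X 0; last by rewrite pmulr_rge0 ?subr_ge0// lt_def Xp.
move=> _; rewrite X1 mul0r; suff -> : T = 0 by rewrite expr0n.
rewrite /T big_seq big1// => i ir; move/eqP: X1.
rewrite psumr_eq0; last by move=> j _; exact: sqr_ge0.
by move=> /allP/(_ _ ir)/=; rewrite sqrf_eq0 => /eqP->; rewrite mulr0.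
Qed.

Definition jweight (R : realType) (a b : nat) : {poly R} :=
  (1 - 'X) ^+ a * (1 + 'X) ^+ b.

Section Christoffel.
Variables (R : realType) (a b : nat) (J : nat -> {poly R}).
Hypothesis hJ : orthonormal_jacobi a b J.
Implicit Types (A : {poly R}) (s : nat) (x : R).

Lemma int11_jacobi l m : int11 (jweight R a b * J l * J m) = (l == m)%:R.
Proof.
rewrite -hJ.2 /int11; apply: eq_Rintegral => x _.
by rewrite !hornerE; ring.
Qed.

(** As [J s] has degree exactly [s], subtracting a multiple of it removes the coefficient of index
    [s]. *)
Lemma jacobi_span A s : (size A <= s)%N ->
  exists c : nat -> R, A = \sum_(0 <= l < s) c l *: J l.
Proof.
elim: s A => [|s IH] A sA.
  exists (fun=> 0); rewrite big_geq//.
  by apply/eqP; rewrite -size_poly_eq0 -leqn0.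
have Js : (J s)`_s != 0.
  by have := hJ.1 s; rewrite -[X in _`_X]/(s.+1.-1) => <-;
    rewrite -lead_coefE lead_coef_eq0 -size_poly_eq0 hJ.1.
have [|c cE] := IH (A - (A`_s / (J s)`_s) *: J s).
  apply/leq_sizeP => j; rewrite leq_eqVlt => /predU1P[<-|sj].
    by rewrite !coefE divfK// subrr.
  rewrite !coefE [A`_j]nth_default ?(leq_trans sA)//.
  by rewrite [(J s)`_j]nth_default ?hJ.1// mulr0 subr0.
exists (fun l => if l == s then A`_s / (J s)`_s else c l).
rewrite big_nat_recr//= eqxx -[LHS](subrK (A`_s / (J s)`_s *: J s)) cE.
by congr (_ + _); apply: eq_big_nat => l /andP[_ ls]; rewrite ltn_eqF.
Qed.

(** Parseval identity: orthonormality kills the off-diagonal terms. *)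
Lemma int11_jacobi_sum (c : nat -> R) s (A := \sum_(0 <= l < s) c l *: J l) :
  int11 (jweight R a b * A ^+ 2) = \sum_(0 <= l < s) c l ^+ 2.
Proof.
rewrite expr2 mulrA {2}/A mulr_sumr int11_sum.
apply: eq_big_nat => m /andP[_ ms].
rewrite -scalerAr int11Z expr2; congr (_ * _).
rewrite /A mulr_sumr mulr_suml int11_sum.
rewrite (bigD1_seq m) ?mem_index_iota ?iota_uniq//=.
rewrite big1 => [|l lm]; rewrite -scalerAr -scalerAl int11Z int11_jacobi.
  by rewrite eqxx mulr1 addr0.
by rewrite (negbTE lm) mulr0.
Qed.

(** The diagonal of the reproducing kernel; for [s > 0] the classical Christoffel function is its
    reciprocal. *)
Definition christoffel s x : R := \sum_(0 <= l < s) (J l).[x] ^+ 2.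

Lemma christoffel_ge0 s x : 0 <= christoffel s x.
Proof. by apply: sumr_ge0 => i _; exact: sqr_ge0. Qed.

(** Cauchy-Schwarz on the expansion of [A] in the basis; Parseval turns the squared coefficients
    into the integral. *)
Lemma le_christoffel A s x : (size A <= s)%N ->
  A.[x] ^+ 2 <= christoffel s x * int11 (jweight R a b * A ^+ 2).
Proof.
move=> /jacobi_span[c ->]; rewrite int11_jacobi_sum horner_sum.
under eq_bigr do rewrite hornerZ.
exact: sum_sqr_CauchySchwarz.
Qed.

(** The witness is the reproducing kernel with one argument frozen at [x]; it gives equality in
    [le_christoffel]. *)
Lemma christoffel_extremal s x : exists A, [/\ (size A <= s)%N,
  A.[x] = christoffel s x &
  int11 (jweight R a b * A ^+ 2) = christoffel s x].
Proof.
exists (\sum_(0 <= l < s) (J l).[x] *: J l); split.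
- rewrite big_nat; apply: (big_ind (fun p : {poly R} => size p <= s)%N).
  + by rewrite size_poly0.
  + by move=> p q ps qs; rewrite (leq_trans (size_polyD _ _))// geq_max ps.
  + by move=> l /andP[_ ls]; rewrite (leq_trans (size_scale_leq _ _))// hJ.1.
- by rewrite horner_sum; apply: eq_bigr => l _; rewrite hornerZ -expr2.
- exact: int11_jacobi_sum.
Qed.

End Christoffel.

(** * Uniform norm and monotonicity of polynomials *)

Lemma continuous_horner_sqrt (R : realType) (p : {poly R}) :
  {within `[-1, 1], continuous (fun x => Num.sqrt (1 - x ^+ 2) * p.[x])}.
Proof.
apply: continuous_subspaceT => x; apply: cvgM; last exact: continuous_horner.
apply: continuous_comp; last exact: sqrt_continuous.
have -> : (fun x : R => 1 - x ^+ 2) = horner (1 - 'X ^+ 2).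
  by apply/funext => y; rewrite !hornerE.
exact: continuous_horner.
Qed.

Lemma le_unorm (R : realType) (f : R -> R) x :
  {within `[-1, 1], continuous f} -> -1 <= x <= 1 -> `|f x| <= unorm f.
Proof.
move=> /unorm_attained[c _ [-> cmax]] x11; apply: cmax.
by rewrite in_itv.
Qed.

Lemma unorm_le (R : realType) (f : R -> R) M :
  (forall x, -1 <= x <= 1 -> `|f x| <= M) -> unorm f <= M.
Proof.
move=> fM; apply: ge_sup.
  by exists `|f 0|, 0 => //=; rewrite in_itv/=; lra.
by move=> _ [x + <-]; rewrite /= in_itv/=; exact: fM.
Qed.

(** For the direct implication, the derivative at [x] is the value there of the polynomial
    difference quotient [q], nonnegative at all other points by monotonicity. Endpoints are thereby
    included. *)
Lemma homo_nonneg11_deriv (R : realType) (p : {poly R}) :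
  {in `[-1, 1] &, {homo horner p : x y / x <= y}} <-> nonneg11 p^`().
Proof.
split=> [ph x x11|p'0]; last first.
  apply: ler_hornerW => x; rewrite in_itv/= => /andP[x1 x2].
  by apply: p'0; rewrite !ltW.
have /factor_theorem[q qE] : root (p - p.[x]%:P) x.
  by rewrite rootE !hornerE subrr.
have := congr1 (fun r => r^`().[x]) qE.
rewrite derivB derivC subr0 derivM derivXsubC !hornerE subrr mulr0 add0r => ->.
apply: (nonneg11_punctured x11) => // y y11 yx.
have := congr1 (horner^~ y) qE; rewrite !hornerE => pq.
have [xy|yx'] := leP x y.
  have : 0 <= p.[y] - p.[x] by rewrite subr_ge0 ph// in_itv.
  by rewrite pq pmulr_lge0// subr_gt0 lt_neqAle eq_sym yx.
have : p.[y] - p.[x] <= 0 by rewrite subr_le0 ph ?in_itv// ltW.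
by rewrite pq nmulr_lle0// subr_lt0.
Qed.

Lemma homoN_nonneg11_deriv (R : realType) (p : {poly R}) :
  {in `[-1, 1] &, {homo horner p : x y /~ x <= y}} <-> nonneg11 (- p)^`().
Proof.
rewrite -homo_nonneg11_deriv.
split=> ph x y x11 y11 xy; have := ph y x y11 x11 xy.
  by rewrite !hornerN lerN2.
by rewrite !hornerN lerN2.
Qed.

Lemma unorm_oppr (R : realType) (f : R -> R) :
  unorm (fun x => - f x) = unorm f.
Proof.
by rewrite /unorm; congr sup; apply: eq_imagel => x _; rewrite normrN.
Qed.

Lemma bernstein_ratioN (R : realType) (p : {poly R}) :
  bernstein_ratio (- p) = bernstein_ratio p.
Proof.
rewrite /bernstein_ratio -[in RHS](unorm_oppr (horner p)) -[in RHS]unorm_oppr.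
congr (unorm _ / unorm _); apply/funext => x; last by rewrite hornerN.
by rewrite derivN hornerN mulNr.
Qed.

(** * Bernstein ratios and integrals of nonnegative polynomials *)

Lemma unorm_ge_int11_deriv (R : realType) (p : {poly R}) :
  int11 p^`() <= 2 * unorm (horner p).
Proof.
have cp : {within `[-1, 1], continuous (horner p)}.
  by apply: continuous_subspaceT => x; exact: continuous_horner.
have p1 : `|p.[1]| <= unorm (horner p) by apply: le_unorm => //; lra.
have pN1 : `|p.[-1]| <= unorm (horner p) by apply: le_unorm => //; lra.
by move: p1 pN1; rewrite int11_deriv !ler_norml; lra.
Qed.

(** Upper bound: up to sign the derivative of [P] is an admissible [Q], and its integral is at most
    twice the norm of [P]. *)
Lemma bernstein_ratio_le (R : realType) (n : nat) (M : R) (P : {poly R}) :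
  0 <= M ->
  (forall Q : {poly R}, (size Q <= n)%N -> nonneg11 Q ->
    forall x, -1 <= x <= 1 -> Num.sqrt (1 - x ^+ 2) * Q.[x] <= M * int11 Q) ->
  monotone_poly n P -> bernstein_ratio P <= 2 * M.
Proof.
move=> M0 QM [sP mP].
wlog P'0 : P sP {mP} / nonneg11 P^`().
  move=> wl; case: mP => [/homo_nonneg11_deriv|/homoN_nonneg11_deriv] P'0.
    exact: wl.
  by rewrite -bernstein_ratioN; apply: wl; rewrite ?size_polyN.
have sP' : (size P^`() <= n)%N.
  by rewrite -ltnS -sP lt_size_deriv// -size_poly_eq0 sP.
rewrite /bernstein_ratio.
(* A zero denominator makes the ratio [0] by convention, and [M0] concludes. *)
have [->|nP0] := eqVneq (unorm (horner P)) 0.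
  by rewrite invr0 mulr0; lra.
have nP : 0 < unorm (horner P).
  rewrite lt_def nP0/= (le_trans (normr_ge0 P.[0]))//.
  apply: le_unorm; last by lra.
  by apply: continuous_subspaceT => x; exact: continuous_horner.
rewrite ler_pdivrMr//; apply: unorm_le => x x11.
rewrite ger0_norm ?mulr_ge0 ?sqrtr_ge0 ?P'0// mulrC.
apply: le_trans (QM _ sP' P'0 x x11) _.
by rewrite mulrAC mulrC ler_wpM2r// ?unorm_ge_int11_deriv.
Qed.

(** Lower bound: [Q] is the derivative of a monotone [P] of norm [int11 Q / 2]. The size of [Q] is
    exact because [monotone_poly] fixes the degree of [P]. *)
Lemma le_bernstein_ratio_size (R : realType) (n : nat) (U : R) (Q : {poly R})
    x :
  (0 < n)%N -> (forall P, monotone_poly n P -> bernstein_ratio P <= U) ->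
  size Q = n -> nonneg11 Q -> -1 <= x <= 1 ->
  2 * (Num.sqrt (1 - x ^+ 2) * Q.[x]) <= U * int11 Q.
Proof.
move=> n0 PU sQ Q0 x11.
(* Centred antiderivative: its norm is half of its total variation. *)
pose A := antideriv Q; pose P := A - ((A.[1] + A.[-1]) / 2)%:P.
have PQ : P^`() = Q by rewrite derivB derivC subr0 deriv_antideriv.
have Qn0 : Q != 0 by rewrite -size_poly_eq0 sQ -lt0n.
have sP : size P = n.+1.
  rewrite size_polyDl size_antideriv ?sQ// size_polyN.
  by rewrite (leq_ltn_trans (size_polyC_leq1 _)).
have hP : {in `[-1, 1] &, {homo horner P : x y / x <= y}}.
  by apply/homo_nonneg11_deriv; rewrite PQ.
have cP : {within `[-1, 1], continuous (horner P)}.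
  by apply: continuous_subspaceT => y; exact: continuous_horner.
have P1 : P.[1] = int11 Q / 2 by rewrite int11E !hornerE; field.
have PN1 : P.[-1] = - (int11 Q / 2) by rewrite int11E !hornerE; field.
have nP : unorm (horner P) = int11 Q / 2.
  apply/eqP; rewrite eq_le; apply/andP; split; last first.
    by rewrite -P1 (le_trans (ler_norm _))//; apply: le_unorm => //; lra.
  apply: unorm_le => y y11; rewrite ler_norml -PN1 -P1.
  by rewrite !hP ?in_itv/= ?lexx ?lerN10//; move: y11; lra.
have wQ : Num.sqrt (1 - x ^+ 2) * Q.[x] <= bernstein_ratio P * unorm (horner P).
  (* If the integral is zero, [P] vanishes on the interval, hence is also nonincreasing, and [Q.[x]
     <= 0]. *)
  have [I0|I0] := eqVneq (int11 Q) 0.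
    rewrite nP I0 !mul0r mulr0.
    have : nonneg11 (- P)^`().
      apply/homoN_nonneg11_deriv => y z; rewrite !in_itv/= => y11 z11 _.
      have Pz t : -1 <= t <= 1 -> P.[t] = 0.
        move=> t11; have := le_unorm cP t11.
        by rewrite nP I0 mul0r normr_le0 => /eqP.
      by rewrite !Pz.
    move=> /(_ _ x11); rewrite derivN hornerN PQ oppr_ge0 => Qx.
    by rewrite mulr_ge0_le0// sqrtr_ge0.
  rewrite /bernstein_ratio divfK;
    last by rewrite nP mulf_neq0// invr_eq0 pnatr_eq0.
  rewrite PQ; under [X in unorm X]eq_fun do rewrite mulrC.
  apply: le_trans (ler_norm _) _.
  exact: (le_unorm (continuous_horner_sqrt (p := Q))).
have I0 : 0 <= int11 Q.
  have : P.[-1] <= P.[1] by apply: hP; rewrite ?in_itv/=; lra.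
  by rewrite P1 PN1; lra.
have : bernstein_ratio P * int11 Q <= U * int11 Q.
  by apply: ler_wpM2r => //; apply: PU; split=> //; left.
by move: wQ; rewrite nP; lra.
Qed.

(** If [a > 0], then [e = a / (|b| + 1)] already makes [a + e * b] positive. *)
Lemma ler_addr_eps (R : realFieldType) (a b : R) :
  (forall e, 0 < e -> a + e * b <= 0) -> a <= 0.
Proof.
move=> ab; rewrite leNgt; apply/negP => a0.
have b1 : 0 < `|b| + 1 by rewrite ltr_wpDl.
have := ab (a / (`|b| + 1)) (divr_gt0 a0 b1).
rewrite -[a in a + _](divfK (lt0r_neq0 b1)) -mulrDr pmulr_rle0 ?divr_gt0//.
by have := ler_norm (- b); rewrite normrN; lra.
Qed.

Lemma le_bernstein_ratio (R : realType) (n : nat) (U : R) (Q : {poly R}) x :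
  (0 < n)%N -> (forall P, monotone_poly n P -> bernstein_ratio P <= U) ->
  (size Q <= n)%N -> nonneg11 Q -> -1 <= x <= 1 ->
  2 * (Num.sqrt (1 - x ^+ 2) * Q.[x]) <= U * int11 Q.
Proof.
move=> n0 PU; rewrite leq_eqVlt => /predU1P[sQ|sQ] Q0 x11.
  exact: le_bernstein_ratio_size n0 PU sQ Q0 x11.
(* Adding [e *: T] restores the full degree and keeps nonnegativity; the inequality is affine in
   [e], which may tend to [0]. *)
pose T : {poly R} := ('X - (-1)%:P) ^+ n.-1.
have sT : size T = n by rewrite size_exp_XsubC prednK.
have T0 : nonneg11 T by move=> y y11; rewrite !hornerE exprn_ge0//; lra.
rewrite -subr_le0.
apply: (@ler_addr_eps _ _
  (2 * (Num.sqrt (1 - x ^+ 2) * T.[x]) - U * int11 T)) => e e0.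
have sQT : size (Q + e *: T) = n.
  by rewrite addrC size_polyDl size_scale ?gt_eqF// sT.
have QT0 : nonneg11 (Q + e *: T).
  by move=> y y11; rewrite hornerD hornerZ addr_ge0 ?mulr_ge0 ?Q0 ?T0// ltW.
have := le_bernstein_ratio_size n0 PU sQT QT0 x11.
by rewrite int11D int11Z hornerD hornerZ -subr_le0; apply: le_trans; lra.
Qed.

(** * Sharp constants for weighted squares *)

Definition christoffel_norm (R : realType) (a b : nat) (J : nat -> {poly R})
    (s : nat) : R :=
  unorm (fun x => Num.sqrt (1 - x ^+ 2) *
    (jweight R a b * \sum_(0 <= l < s) J l ^+ 2).[x]).

Lemma horner_christoffel (R : realType) (a b : nat) (J : nat -> {poly R}) s x :
  (jweight R a b * \sum_(0 <= l < s) J l ^+ 2).[x] =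
  (jweight R a b).[x] * christoffel J s x.
Proof.
rewrite hornerM horner_sum; congr (_ * _).
by apply: eq_bigr => l _; rewrite horner_exp.
Qed.

Lemma nonneg11_jweight (R : realType) (a b : nat) : nonneg11 (jweight R a b).
Proof. by move=> x x11; rewrite !hornerE mulr_ge0// exprn_ge0//; lra. Qed.

Lemma nonneg11_jweight_sqr (R : realType) (a b : nat) (A : {poly R}) :
  nonneg11 (jweight R a b * A ^+ 2).
Proof.
by move=> x x11; rewrite hornerM horner_exp mulr_ge0 ?sqr_ge0 ?nonneg11_jweight.
Qed.

Lemma size_jweight_sqr (R : realType) (a b s n : nat) (A : {poly R}) :
  (a + b + s.*2 = n.+1)%N -> (size A <= s)%N ->
  (size (jweight R a b * A ^+ 2)%R <= n)%N.
Proof.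
move=> e sA; have [->|A0] := eqVneq A 0.
  by rewrite expr0n mulr0 size_poly0.
have A1 : (0 < size A)%N by rewrite lt0n size_poly_eq0.
have size_exp1 (p : {poly R}) m : (size p = 2)%N -> (size (p ^+ m)%R <= m.+1)%N.
  by move=> sp; have := size_poly_exp_leq p m; rewrite sp mul1n.
have sa : (size ((1 - 'X) ^+ a : {poly R})%R <= a.+1)%N.
  by apply: size_exp1; rewrite -size_polyN opprB -[1]/(1%:P) size_XsubC.
have sb : (size ((1 + 'X) ^+ b : {poly R})%R <= b.+1)%N.
  by apply: size_exp1; rewrite addrC -[1]/(1%:P) size_XaddC.
have sw : (size (jweight R a b) <= (a + b).+1)%N.
  rewrite (leq_trans (size_polyMleq _ _))// -subn1 leq_subLR.
  by rewrite (leq_trans (leq_add sa sb))//; lia.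
rewrite (leq_trans (size_polyMleq _ _))// -subn1 leq_subLR.
by rewrite (leq_trans (leq_add sw (size_poly_exp_leq A 2)))//; lia.
Qed.

Lemma int11_ge0 (R : realType) (p : {poly R}) : nonneg11 p -> 0 <= int11 p.
Proof.
move=> p0; rewrite -[p]deriv_antideriv int11_deriv subr_ge0.
have /homo_nonneg11_deriv h : nonneg11 (antideriv p)^`().
  by rewrite deriv_antideriv.
by apply: h; rewrite ?in_itv/=; lra.
Qed.

Section ChristoffelNorm.
Variables (R : realType) (a b : nat) (J : nat -> {poly R}).
Hypothesis hJ : orthonormal_jacobi a b J.
Implicit Types (A : {poly R}) (s : nat) (x : R).

Lemma christoffel_norm_ub s x : -1 <= x <= 1 ->
  Num.sqrt (1 - x ^+ 2) * ((jweight R a b).[x] * christoffel J s x) <=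
  christoffel_norm a b J s.
Proof.
move=> x11; rewrite -horner_christoffel; apply: le_trans (ler_norm _) _.
exact: (le_unorm (continuous_horner_sqrt
  (p := jweight R a b * \sum_(0 <= l < s) J l ^+ 2))).
Qed.

Lemma christoffel_norm_ge0 s : 0 <= christoffel_norm a b J s.
Proof.
apply: le_trans (christoffel_norm_ub s (_ : -1 <= 0 <= 1)); last by lra.
rewrite mulr_ge0 ?sqrtr_ge0 ?mulr_ge0 ?christoffel_ge0//.
by apply: nonneg11_jweight; lra.
Qed.

Lemma jweight_sqr_le A s x : -1 <= x <= 1 -> (size A <= s)%N ->
  Num.sqrt (1 - x ^+ 2) * (jweight R a b * A ^+ 2).[x] <=
  christoffel_norm a b J s * int11 (jweight R a b * A ^+ 2).
Proof.
move=> x11 sA; have I0 := int11_ge0 (@nonneg11_jweight_sqr _ a b A).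
apply: le_trans (ler_wpM2r I0 (christoffel_norm_ub s x11)).
rewrite hornerM horner_exp -[leRHS]mulrA ler_wpM2l ?sqrtr_ge0// -mulrA.
by rewrite ler_wpM2l ?nonneg11_jweight// (le_christoffel hJ).
Qed.

(** Optimality: for the weight [w] times the square of the extremal [A] at [x], with kernel value
    [K], the value at [x] is [w K^2] and the integral is [K], so one factor [K] cancels. *)
Lemma christoffel_norm_le (n s : nat) (U : R) :
  (0 < n)%N -> (a + b + s.*2 = n.+1)%N ->
  (forall P, monotone_poly n P -> bernstein_ratio P <= U) ->
  2 * christoffel_norm a b J s <= U.
Proof.
move=> n0 e PU; rewrite mulrC -ler_pdivlMr//.
apply: unorm_le => x x11; rewrite horner_christoffel.
have w0 : 0 <= (jweight R a b).[x] by exact: nonneg11_jweight.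
have K0 := christoffel_ge0 J s x.
rewrite ger0_norm ?mulr_ge0 ?sqrtr_ge0// ler_pdivlMr// mulrC.
have [A [sA AK IK]] := christoffel_extremal hJ s x.
have := le_bernstein_ratio n0 PU (size_jweight_sqr e sA)
  (@nonneg11_jweight_sqr _ a b A) x11.
rewrite IK hornerM horner_exp AK.
have [-> _|K1] := eqVneq (christoffel J s x) 0; last first.
  have Kp : 0 < christoffel J s x by rewrite lt_def K1.
  by rewrite expr2 !mulrA ler_pM2r.
(* A zero kernel, as for [s = 0], leaves [0 <= U], obtained from the constant polynomial [1] at the
   point [0]. *)
rewrite !mulr0; suff : 0 <= U by lra.
have I1 : int11 (1 : {poly R}) = 2.
  by rewrite -derivX int11_deriv !hornerX; ring.
have H1 y : (1 : {poly R}).[y] = 1 by rewrite hornerE.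
have := @le_bernstein_ratio R n U 1 0 n0 PU.
rewrite size_poly1 I1 H1 expr0n subr0 sqrtr1 => /(_ n0) U0.
suff : 2 * (1 * 1) <= U * 2 by lra.
by apply: U0 => [y _|]; rewrite ?H1//; lra.
Qed.

End ChristoffelNorm.

(** Substituting [- x] turns [1 - 'X] into [1 + 'X] and fixes [1 - x ^+ 2], so the constant for
    [(0, 1)] also serves [(1, 0)]. *)
Lemma jweight_sqr_le_refl (R : realType) (J : nat -> {poly R})
    (hJ : orthonormal_jacobi 0 1 J) (A : {poly R}) s x :
  -1 <= x <= 1 -> (size A <= s)%N ->
  Num.sqrt (1 - x ^+ 2) * (jweight R 1 0 * A ^+ 2).[x] <=
  christoffel_norm 0 1 J s * int11 (jweight R 1 0 * A ^+ 2).
Proof.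
move=> x11 sA; pose B := A \Po - 'X.
have sB : (size B <= s)%N by rewrite size_comp_poly2 ?size_polyN ?size_polyX.
have Nx11 : -1 <= - x <= 1 by lra.
have := jweight_sqr_le hJ Nx11 sB; rewrite sqrrN -[int11 _]int11_compNX.
have -> : (jweight R 0 1 * B ^+ 2) \Po - 'X = jweight R 1 0 * A ^+ 2.
  rewrite /jweight /B !expr0 !expr1 mul1r mulr1 comp_polyM rmorphXn/=.
  rewrite -comp_polyA raddfN/= comp_polyX opprK comp_polyXr.
  by rewrite comp_polyD comp_polyX -[1]/(1%:P) comp_polyC.
have -> : (jweight R 0 1 * B ^+ 2).[- x] = (jweight R 1 0 * A ^+ 2).[x].
  by rewrite !hornerM !horner_exp horner_comp !expr0 !hornerE opprK.
exact.
Qed.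

(** * Assembly of the two suprema *)

Lemma lukacs_le (R : realType) (n : nat) (M x : R) :
  (forall (a b s : nat) (A : {poly R}), (a <= 1)%N -> (b <= 1)%N ->
    (a + b + s.*2 = n.+1)%N -> (size A <= s)%N ->
    Num.sqrt (1 - x ^+ 2) * (jweight R a b * A ^+ 2).[x] <=
    M * int11 (jweight R a b * A ^+ 2)) ->
  forall Q, lukacs n Q -> Num.sqrt (1 - x ^+ 2) * Q.[x] <= M * int11 Q.
Proof.
(* Both sides are additive in [Q], so a constant [M] common to all generators suffices. *)
move=> gen Q; elim=> [|p q _ hp _ hq|a b s A a1 b1 e sA].
- by rewrite hornerC int110 !mulr0.
- by rewrite hornerD int11D !mulrDr lerD.
- exact: gen e sA.
Qed.

Lemma ereal_sup_eq_fin (R : realType) (T : Type) (S : set T) (f : T -> R)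
    (v : R) :
  (forall P, S P -> f P <= v) ->
  (forall U, (forall P, S P -> f P <= U) -> v <= U) ->
  ereal_sup [set (f P)%:E | P in S] = v%:E.
Proof.
move=> Sv vS; apply/eqP; rewrite eq_le; apply/andP; split.
  by apply: ge_ereal_sup => _ [P SP <-]; rewrite lee_fin Sv.
have fs P : S P -> ((f P)%:E <= ereal_sup [set (f P)%:E | P in S])%E.
  by move=> SP; apply: ereal_sup_ubound; exists P.
case: (ereal_sup _) fs => [r fs||fs]; rewrite ?leey// ?lee_fin.
  by apply: vS => P /fs; rewrite lee_fin.
(* A supremum [-oo] would make every real an upper bound, [v - 1] included. *)
exfalso; suff : v <= v - 1 by lra.
by apply: vS => P /fs; rewrite leeNy_eq.
Qed.

Theorem corollary2p3 (R : realType) (J : nat -> nat -> nat -> {poly R})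
    (hJ : forall a b : nat, (a <= 1)%N -> (b <= 1)%N ->
       orthonormal_jacobi a b (J a b))
    (k : nat) :
  ereal_sup [set (bernstein_ratio P)%:E | P in monotone_poly (2 * k + 2)%N] =
    (2 * unorm (fun x => Num.sqrt (1 - x ^+ 2) * Sfun J k x))%:E /\
  ereal_sup [set (bernstein_ratio P)%:E | P in monotone_poly (2 * k + 1)%N] =
    (2 * Num.max (unorm (fun x => Num.sqrt (1 - x ^+ 2) * Hfun J k x))
                 (unorm (fun x => Num.sqrt (1 - x ^+ 2) * Ffun J k x)))%:E.
Proof.
(* The norms of [Sfun], [Hfun] and [Ffun] are the cases [(a, b, s)] equal to [(0, 1, k + 1)],
   [(1, 1, k)] and [(0, 0, k + 1)]. *)
have normE a b s (f : R -> R) :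
    (forall x, f x = (1 - x) ^+ a * (1 + x) ^+ b * christoffel (J a b) s x) ->
    unorm (fun x => Num.sqrt (1 - x ^+ 2) * f x) =
    christoffel_norm a b (J a b) s.
  move=> fE; congr unorm; apply/funext => x.
  by rewrite horner_christoffel fE !hornerE.
rewrite (@normE 0%N 1%N k.+1); last by move=> x; rewrite expr0 expr1 mul1r.
rewrite (@normE 1%N 1%N k);
  last by move=> x; rewrite !expr1 /Hfun; congr (_ * _); ring.
rewrite (@normE 0%N 0%N k.+1); last by move=> x; rewrite !expr0 !mul1r.
have h00 := hJ 0%N 0%N isT isT; have h01 := hJ 0%N 1%N isT isT.
have h11 := hJ 1%N 1%N isT isT.
split; apply: ereal_sup_eq_fin => [P|U PU].
- apply: bernstein_ratio_le; first exact: christoffel_norm_ge0.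
  move=> Q sQ Q0 x x11; apply: lukacs_le (nonneg11_lukacs sQ Q0).
  (* Here [a + b + 2 s = 2 k + 3], so exactly one of [a], [b] is [1] and [s = k + 1]. *)
  move=> [|[|//]] [|[|//]] s A _ _ e sA; try lia.
  + have -> : k.+1 = s by lia.
    exact: jweight_sqr_le.
  + have -> : k.+1 = s by lia.
    exact: jweight_sqr_le_refl.
- by apply: (@christoffel_norm_le _ _ _ _ h01 (2 * k + 2)%N); rewrite ?PU//; lia.
- apply: bernstein_ratio_le.
    by rewrite le_max christoffel_norm_ge0.
  move=> Q sQ Q0 x x11; apply: lukacs_le (nonneg11_lukacs sQ Q0).
  move=> a b s A a1 b1 e sA.
  suff [hab h] : orthonormal_jacobi a b (J a b) /\
      christoffel_norm a b (J a b) s <=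
      Num.max (christoffel_norm 1 1 (J 1%N 1%N) k)
              (christoffel_norm 0 0 (J 0%N 0%N) k.+1).
    apply: le_trans (jweight_sqr_le hab x11 sA) _.
    by rewrite ler_wpM2r// int11_ge0//; exact: nonneg11_jweight_sqr.
  (* Here [a + b + 2 s = 2 k + 2], so [a = b = 0] with [s = k + 1], or [a = b = 1] with [s = k]:
     hence the maximum of two norms. *)
  move: a b a1 b1 e => [|[|//]] [|[|//]] _ _ e; try lia.
  + have -> : s = k.+1 by lia.
    by split=> //; rewrite le_max lexx orbT.
  + have -> : s = k by lia.
    by split=> //; rewrite le_max lexx.
- rewrite mulrC -ler_pdivlMr// ge_max !ler_pdivlMr// ![_ * 2]mulrC.
  apply/andP; split.
  + by apply: (@christoffel_norm_le _ _ _ _ h11 (2 * k + 1)%N); rewrite ?PU//; lia.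
  + by apply: (@christoffel_norm_le _ _ _ _ h00 (2 * k + 1)%N); rewrite ?PU//; lia.
Qed.
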